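(* Let $\alpha$ be a countable ordinal with finite big Ramsey degrees. For any choice of integers $s \ge 1$ and $n_0, \ldots, n_{s-1} \ge 1$ there is an integer $t = t(\alpha, n_0, \ldots, n_{s-1})$ such that for every integer $k \ge 2$ and every coloring $$\chi : \mathrm{Emb}(n_0, \alpha) \times \ldots \times \mathrm{Emb}(n_{s-1}, \alpha) \to k$$ there is a $U \subseteq \alpha$ order-isomorphic to $\alpha$ such that $$|\chi(\mathrm{Emb}(n_0, U) \times \ldots \times \mathrm{Emb}(n_{s-1}, U))| \le t.$$
   Context: For a chain (linearly ordered set) $C$ and a finite chain $n=\{0<1<\dots<n-1\}$, let $\mathrm{Emb}(n,C)$ be the set of order embeddings $n \hookrightarrow C$; a coloring with $k$ colors is a map to $k=\{0,\dots,k-1\}$. The big Ramsey degree $T(n,C)$ is the least positive integer $t$ such that for every integer $k \ge 2$ and every coloring $\chi : \mathrm{Emb}(n, C) \to k$ there is a $U \subseteq C$ order-isomorphic to $C$ with $|\chi(\mathrm{Emb}(n, U))| \le t$; if no such $t$ exists, $T(n,C)=\infty$. A chain $C$ has finite big Ramsey degrees if $T(n,C)<\infty$ for all integers $n\ge 1$. *)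

(* Defs.v *)
From HB Require Import structures.
From mathcomp Require Import all_boot all_order.
From mathcomp Require Import boolp classical_sets functions cardinality.

Set Implicit Arguments.
Unset Strict Implicit.
Unset Printing Implicit Defensive.

Import Order.TTheory.
Local Open Scope classical_set_scope.
Local Open Scope card_scope.
Local Open Scope order_scope.

Record emb (n : nat) {d : Order.disp_t} (C : orderType d) := Emb {
  emb_fun :> 'I_n -> C;
  emb_mono : {mono emb_fun : i j / i <= j}
}.

(* Emb(n, U) for U a subset of C, seen inside Emb(n, C). *)
Definition emb_in (n : nat) {d : Order.disp_t} (C : orderType d) (U : set C) :
  set (emb n C) := [set f | forall i, U (f i)].
Arguments emb_in n {d C} U.

Definition isomorphic_copy {d : Order.disp_t} (C : orderType d) (U : set C) :
  Prop :=
  exists f : C -> C, set_bij [set: C] U f /\ {mono f : x y / x <= y}.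

Definition ramsey_bound (n : nat) {d : Order.disp_t} (C : orderType d)
  (t : nat) : Prop :=
  forall k : nat, (2 <= k)%N -> forall chi : emb n C -> 'I_k,
  exists U : set C, isomorphic_copy U /\ chi @` emb_in n U #<= `I_t.

(* T(n, C), with None standing for infinity. *)
Definition big_ramsey_degree (n : nat) {d : Order.disp_t} (C : orderType d) :
  option nat :=
  if pselect (exists t, (0 < t)%N && `[< ramsey_bound n C t >]) is left tP
  then Some (ex_minn tP) else None.

Definition finite_big_ramsey_degrees {d : Order.disp_t} (C : orderType d) :
  Prop :=
  forall n : nat, (1 <= n)%N -> big_ramsey_degree n C <> None.

(* A countable ordinal, given as a countable (possibly finite or empty) chain
   whose strict order is well-founded. *)
Definition countable_ordinal {d : Order.disp_t} (C : orderType d) : Prop :=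
  well_founded (fun x y : C => x < y) /\ countable [set: C].

(* Emb(n_0, U) x ... x Emb(n_{s-1}, U), inside the product of the
   Emb(n_i, C). *)
Definition emb_prod_in (s : nat) (n : 'I_s -> nat) {d : Order.disp_t}
  (C : orderType d) (U : set C) : set (forall i : 'I_s, emb (n i) C) :=
  [set e | forall i, emb_in (n i) U (e i)].
Arguments emb_prod_in {s} n {d C} U.

(* Main.v *)
Require Import Defs.
From HB Require Import structures.
From mathcomp Require Import all_boot all_order.
From mathcomp Require Import boolp classical_sets functions cardinality.

Set Implicit Arguments.
Unset Strict Implicit.
Unset Printing Implicit Defensive.

Import Order.TTheory.
Local Open Scope classical_set_scope.
Local Open Scope card_scope.
Local Open Scope order_scope.

(** The points occurring in a tuple (e_0, ..., e_{s-1}) of embeddings form a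
    finite chain, i.e. an embedding g of some m with
    1 <= m <= n_0 + ... + n_{s-1}; the tuple is recovered from g and from its
    type, the family of maps tau_i : n_i -> m with e_i = g o tau_i. For fixed m
    there are finitely many types, so colouring g by the function sending each
    type to the colour of the corresponding tuple is a finite colouring of
    Emb(m, alpha). Shrinking alpha successively for each m leaves boundedly many
    such functions, each taking boundedly many values. *)

Lemma card_le_mem_seq (T : eqType) (A : set T) (l : seq T) :
  (forall x, A x -> x \in l) -> A #<= `I_(size l).
Proof.
case: l => [|x0 l] Al.
  suff -> : A = set0 by apply: card_ge0.
  by apply/seteqP; split => // x /Al.
have /subset_card_le : A `<=` nth x0 (x0 :: l) @` `I_(size (x0 :: l)).
  move=> x /Al xl; exists (index x (x0 :: l)); last exact: nth_index.
  by move: xl; rewrite -index_mem.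
by move/card_le_trans; apply; apply: card_image_le.
Qed.

Lemma mem_seq_card_le (K : finType) (A : set K) (t : nat) :
  A #<= `I_t -> exists2 l : seq K, (size l <= t)%N & forall x, A x -> x \in l.
Proof.
move=> /pcard_leP[f].
exists (enum [pred x | `[< A x >]]); last first.
  by move=> x Ax; rewrite mem_enum; apply/asboolP.
rewrite -(size_map f) -[X in (_ <= X)%N](size_iota 0).
apply: uniq_leq_size.
  rewrite map_inj_in_uniq ?enum_uniq // => x y.
  rewrite !mem_enum => /asboolP Ax /asboolP Ay.
  by move=> fxy; apply: (inj _ _ fxy); apply: mem_set.
move=> _ /mapP[x + ->]; rewrite mem_enum => /asboolP Ax.
by rewrite mem_iota /= add0n; apply: (@funS _ _ _ _ f).
Qed.

Lemma le_mono_comp (d1 d2 d3 : Order.disp_t) (P1 : porderType d1)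
    (P2 : porderType d2) (P3 : porderType d3) (f : P2 -> P3) (g : P1 -> P2) :
  {mono f : x y / x <= y} -> {mono g : x y / x <= y} ->
  {mono f \o g : x y / x <= y}.
Proof. by move=> fm gm x y /=; rewrite fm gm. Qed.

Section Embeddings.
Context {d : Order.disp_t} {C : orderType d}.

Lemma emb_ext (n : nat) (e e' : emb n C) : e =1 e' -> e = e'.
Proof.
case: e e' => [f fm] [g gm] /= /funext fg; subst g.
by rewrite (Prop_irrelevance fm gm).
Qed.

Definition emb_comp (f : C -> C) (fm : {mono f : x y / x <= y}) (n : nat)
    (e : emb n C) : emb n C :=
  @Emb n d C (f \o e) (le_mono_comp fm (@emb_mono n d C e)).

Lemma isomorphic_copy_range (f : C -> C) :
  {mono f : x y / x <= y} -> isomorphic_copy (range f).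
Proof.
move=> fm; exists f; split => //; split => //.
by move=> x y _ _ /(inc_inj fm).
Qed.

Lemma emb_in_range (f : C -> C) (fm : {mono f : x y / x <= y}) (n : nat)
    (e : emb n C) :
  emb_in n (range f) e -> exists e', e = emb_comp fm e'.
Proof.
move=> fe; have /choice[g gE] : forall i, exists x, f x = e i.
  by move=> i; have [x _ <-] := fe i; exists x.
have gm : {mono g : i j / i <= j}.
  by move=> i j; rewrite -fm !gE emb_mono.
by exists (Emb gm); apply: emb_ext => i /=; rewrite gE.
Qed.

Lemma emb_of_sorted (l : seq C) (x0 : C) : sorted <%O l ->
  {g : emb (size l) C | forall i, g i = nth x0 l i}.
Proof.
move=> sl; have gm : {mono (fun i : 'I_(size l) => nth x0 l i) : i j / i <= j}.
  move=> i j; rewrite lt_sorted_leq_nth ?inE ?ltn_ord //.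
by exists (Emb gm).
Qed.

Lemma finite_big_ramsey_degreesP :
  finite_big_ramsey_degrees C ->
  forall n, (1 <= n)%N -> exists t, @ramsey_bound n d C t.
Proof.
move=> Cfin n n1; have := Cfin n n1; rewrite /big_ramsey_degree.
case: pselect => // -[t /andP[_ /asboolP tP]] _.
by exists t.
Qed.

(** Working form of the Ramsey bound: representing the copy by a self-embedding [f] lets successive
    shrinkings be composed, and listing the surviving colours reduces later counting to sizes of
    sequences. *)
Lemma ramsey_boundP (n t : nat) : @ramsey_bound n d C t ->
  forall (K : finType) (chi : emb n C -> K),
  exists (f : C -> C) (fm : {mono f : x y / x <= y}) (l : seq K),
    (size l <= t)%N /\ forall e, chi (emb_comp fm e) \in l.
Proof.
move=> nt K chi.
(* [ramsey_bound] only speaks of palettes with at least two colours. *)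
pose h : K -> 'I_(2 + #|K|) := @rshift 2 #|K| \o enum_rank.
have [|U [[f [fU fm]] Ut]] := nt _ _ (h \o chi); first exact: leq_addr.
have chiUt : chi @` emb_in n U #<= `I_t.
  apply: card_le_trans Ut; rewrite -image_comp.
  have /inj_card_eq : {in chi @` emb_in n U &, injective h}.
    by move=> x y _ _ /rshift_inj/enum_rank_inj.
  by rewrite card_eq_le => /andP[].
have [l lt Ul] := mem_seq_card_le chiUt.
exists f, fm, l; split => // e; apply: Ul; exists (emb_comp fm e) => // i.
by have [fun_f _ _] := fU; apply: fun_f.
Qed.

(** Induction on [N]: the lists already obtained remain valid when the copy is shrunk further. Since
    [t] is fixed before the palettes [K], it cannot depend on the number of colours. *)
Lemma simultaneous_ramsey_bound :
  finite_big_ramsey_degrees C -> forall N, exists t,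
  forall (K : nat -> finType) (chi : forall m, emb m C -> K m),
  exists (f : C -> C) (fm : {mono f : x y / x <= y}), forall m,
  exists l : seq (K m), (size l <= t)%N /\
    ((1 <= m <= N)%N -> forall e, chi m (emb_comp fm e) \in l).
Proof.
move=> Cfin; elim=> [|N [t1 IH]].
  exists 0%N => K chi; exists id, (fun _ _ => erefl) => m.
  by exists [::]; split => //; case: m.
have [t2 /ramsey_boundP ramN] := finite_big_ramsey_degreesP Cfin (ltn0Sn N).
exists (maxn t1 t2) => K chi.
have [f1 [f1m f1P]] := IH K chi.
(* Pulling the colouring of size [N.+1] back along [f1] places the new copy inside the previous
   one. *)
have [f2 [f2m [l2 [l2t l2P]]]] :=
  ramN _ (fun e => chi N.+1 (emb_comp f1m e)).
have compE m (e : emb m C) :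
    emb_comp (le_mono_comp f1m f2m) e = emb_comp f1m (emb_comp f2m e).
  exact: emb_ext.
exists (f1 \o f2), (le_mono_comp f1m f2m) => m.
have [->|mN] := eqVneq m N.+1.
  exists l2; split; first by rewrite leq_max l2t orbT.
  by move=> _ e; rewrite compE.
have [l1 [l1t l1P]] := f1P m; exists l1; split; first by rewrite leq_max l1t.
move=> /andP[m1 mN1] e; rewrite compE; apply: l1P.
by rewrite m1 -ltnS ltn_neqAle mN.
Qed.

Section TupleTypes.
Context {s : nat} (n : 'I_s -> nat).

(** The family of maps tau_i is encoded as one finite function on the disjoint union of the n_i, so
    that types form a [finType] whose cardinality can enter the bound. *)
Definition tuple_type (m : nat) := {ffun {i : 'I_s & 'I_(n i)} -> 'I_m}.

Definition has_type m (g : emb m C) (tau : tuple_type m)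
    (e : forall i, emb (n i) C) :=
  forall i j, e i j = g (tau (Tagged (fun i => 'I_(n i)) j)).

Lemma has_type_inj m (g : emb m C) tau e e' :
  has_type g tau e -> has_type g tau e' -> e = e'.
Proof.
move=> eP e'P; apply: functional_extensionality_dep => i.
by apply: emb_ext => j; rewrite eP e'P.
Qed.

(** Take for [g] the increasing enumeration of the distinct points of the tuple and for [tau] the
    index of each point in it; [p0] guarantees at least one point. *)
Lemma exists_type (e : forall i, emb (n i) C) (p0 : {i : 'I_s & 'I_(n i)}) :
  exists m (g : emb m C) (tau : tuple_type m),
    (1 <= m <= #|{: {i : 'I_s & 'I_(n i)}}|)%N /\ has_type g tau e.
Proof.
pose pt (p : {i : 'I_s & 'I_(n i)}) := e (tag p) (tagged p).
pose l := sort <=%O (undup (codom pt)).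
have memE p : pt p \in l by rewrite mem_sort mem_undup codom_f.
have [|g gE] := @emb_of_sorted l (pt p0).
  by rewrite sort_lt_sorted undup_uniq.
have idx p : (index (pt p) l < size l)%N by rewrite index_mem.
exists (size l), g, [ffun p => Ordinal (idx p)]; split.
  apply/andP; split; first exact: leq_ltn_trans (idx p0).
  by rewrite size_sort (leq_trans (size_undup _)) // size_codom.
by move=> i j; rewrite ffunE gE nth_index // memE.
Qed.

Variables (K : finType) (c0 : K) (chi : (forall i, emb (n i) C) -> K).

(* [c0] is a junk colour for the maps [tau] that are not the type of a tuple. *)
Definition type_coloring m (g : emb m C) : {ffun tuple_type m -> K} :=
  [ffun tau => if pselect (exists e, has_type g tau e) is left h
               then chi (projT1 (cid h)) else c0].

(** By [has_type_inj], the tuple picked by choice can only be [e]. *)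
Lemma type_coloringE m (g : emb m C) tau e :
  has_type g tau e -> type_coloring g tau = chi e.
Proof.
move=> ge; rewrite ffunE; case: pselect => [h|[]]; last by exists e.
by case: cid => e' /= ge'; rewrite (has_type_inj ge' ge).
Qed.

End TupleTypes.
End Embeddings.

Theorem theorem4p5 (d : Order.disp_t) (alpha : orderType d)
  (halpha : countable_ordinal alpha)
  (hfin : finite_big_ramsey_degrees alpha)
  (s : nat) (hs : (1 <= s)%N)
  (n : 'I_s -> nat) (hn : forall i : 'I_s, (1 <= n i)%N) :
  exists t : nat,
    forall k : nat, (2 <= k)%N ->
      forall chi : (forall i : 'I_s, emb (n i) alpha) -> 'I_k,
      exists U : set alpha,
        isomorphic_copy U /\ chi @` emb_prod_in n U #<= `I_t.
Proof.
pose p0 : {i : 'I_s & 'I_(n i)} :=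
  Tagged (fun i => 'I_(n i)) (Ordinal (hn (Ordinal hs))).
pose N := #|{: {i : 'I_s & 'I_(n i)}}|.
have [t tP] := simultaneous_ramsey_bound hfin N.
(* For each [m], at most [t] functions survive, each with at most one value per type. *)
exists (\sum_(m < N.+1) t * #|{: tuple_type n m}|)%N => k k2 chi.
pose c0 : 'I_k := Ordinal (ltnW k2).
have [f [fm fP]] := tP (fun m => {ffun tuple_type n m -> 'I_k} : finType)
  (@type_coloring _ _ _ n _ c0 chi).
exists (range f); split; first exact: isomorphic_copy_range.
pose l m := projT1 (cid (fP m)).
have lt m : (size (l m) <= t)%N by rewrite /l; case: cid => ? [].
have lP m : (1 <= m <= N)%N ->
    forall e : emb m alpha, type_coloring c0 chi (emb_comp fm e) \in l m.
  by rewrite /l; case: cid => ? [].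
pose colors := flatten [seq [seq (v : {ffun _ -> _}) tau |
  v <- l m, tau <- enum {: tuple_type n m}] | m : 'I_N.+1 <- enum 'I_N.+1].
have colors_le : (size colors <= \sum_(m < N.+1) t * #|{: tuple_type n m}|)%N.
  rewrite size_flatten /shape -map_comp sumnE big_map big_enum /=.
  by apply: leq_sum => m _; rewrite size_allpairs -cardE leq_mul2r lt orbT.
apply: (@card_le_trans _ _ _ `I_(size colors)); last by rewrite card_le_II.
apply: card_le_mem_seq => _ [e fe <-].
(* The tuple is pulled back through [f] before its type is taken, so that its points are enumerated
   by some [emb_comp fm g], to which [lP] applies. *)
pose e' i := projT1 (cid (emb_in_range fm (fe i))).
have e'E i : e i = emb_comp fm (e' i) by rewrite /e'; case: cid.
have [m [g [tau [mN ge']]]] := exists_type e' p0.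
have ge : has_type (emb_comp fm g) tau e by move=> i j; rewrite e'E /= ge'.
rewrite -(type_coloringE c0 chi ge).
have mN1 : (m < N.+1)%N by rewrite ltnS; case/andP: mN.
apply/flattenP; eexists.
  by apply/mapP; exists (Ordinal mN1); rewrite ?mem_enum.
by apply/allpairsP; exists (type_coloring c0 chi (emb_comp fm g), tau);
  rewrite lP ?mem_enum.
Qed.
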